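(* Let $K$ be a field, let $x=(x_1,\dots,x_r)$ and $y=(y_1,\dots,y_s)$ be disjoint lists of indeterminates, and let $f\in K[x]$ and $g\in K[y]$. (1) Let $X$ be a $3$-matrix factorization of $f$ of size $n$ and let $Y$ be a $3$-matrix factorization of $g$ of size $m$. Then there is a tensor product $\overline{\otimes}_3$ of $3$-matrix factorizations (the multiplicative tensor product, defined componentwise by Kronecker products) which produces a $3$-matrix factorization $X\overline{\otimes}_3 Y$ of the product $fg\in K[x_1,\dots,x_r,y_1,\dots,y_s]$, and $X\overline{\otimes}_3 Y$ is of size $nm$. (2) The multiplicative tensor product of $3$-matrix factorizations $$(-)\,\overline{\otimes}_3\,(-):\; MF(K[x],f)_3\times MF(K[y],g)_3\longrightarrow MF(K[x,y],fg)_3$$ is a bifunctor.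
   Context: For a list of indeterminates $x$, $K(x)$ denotes the field of fractions of the polynomial ring $K[x]$. Matrices over $K(x)$ or over $K(y)$ are regarded as matrices over $K(x,y)$. A $3$-matrix factorization of size $n$ of a polynomial $f\in K[x]$ is a triplet $(\phi,\psi,\theta)$ of $n\times n$ matrices with entries in $K(x)$ such that $\phi\psi\theta=fI_n$. The category $MF(K[x],f)_3$ has as objects the $3$-matrix factorizations of $f$ (of all sizes). A morphism from $(\phi_1,\psi_1,\theta_1)$ of size $n_1$ to $(\phi_2,\psi_2,\theta_2)$ of size $n_2$ is a triplet $(\alpha,\beta,\delta)$ of $n_2\times n_1$ matrices over $K(x)$ such that $\alpha\phi_1=\phi_2\beta$, $\psi_2\delta=\beta\psi_1$ and $\delta\theta_1=\theta_2\alpha$. Composition is componentwise matrix multiplication, $(\alpha_2,\beta_2,\delta_2)\circ(\alpha_1,\beta_1,\delta_1)=(\alpha_2\alpha_1,\beta_2\beta_1,\delta_2\delta_1)$, and the identity of an object of size $n$ is $(I_n,I_n,I_n)$. The categories $MF(K[y],g)_3$ and $MF(K[x,y],fg)_3$ are defined in the same way. The symbol $\otimes$ between matrices is the standard tensor (Kronecker) product. On objects, the multiplicative tensor product is $(\phi,\psi,\theta)\,\overline{\otimes}_3\,(\phi',\psi',\theta')=(\phi\otimes\phi',\psi\otimes\psi',\theta\otimes\theta')$, where $(\phi,\psi,\theta)$ is a $3$-matrix factorization of $f$ and $(\phi',\psi',\theta')$ one of $g$, the components being matrices over $K(x,y)$. On morphisms, $(\alpha_f,\beta_f,\delta_f)\,\overline{\otimes}_3\,(\alpha_g,\beta_g,\delta_g)=(\alpha_f\otimes\alpha_g,\beta_f\otimes\beta_g,\delta_f\otimes\delta_g)$.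 *)

(* Defs.v *)
From HB Require Import structures.
From mathcomp Require Import all_boot all_algebra.
From mathcomp Require Import mpoly mxtens.

Set Implicit Arguments.
Unset Strict Implicit.
Unset Printing Implicit Defensive.

Import GRing.Theory.
Local Open Scope ring_scope.
Local Open Scope quotient_scope.

Notation "p %:F" := (FracField.tofrac p) : ring_scope.
Notation "A *t B" := (tensmx A B)
  (at level 40, left associativity, format "A  *t  B") : ring_scope.

Definition ratfun (K : fieldType) (n : nat) : fieldType :=
  {fraction {mpoly K[n]}}.

Section FracMap.
Variables (A B : idomainType) (h : {rmorphism A -> B}).

(* Computed on a chosen representative; [frac_map_div] shows that the choice
   is irrelevant when [h] is injective. *)
Definition frac_map (u : {fraction A}) : {fraction B} :=
  (h \n_(repr u))%:F / (h \d_(repr u))%:F.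

Lemma frac_reprE (u : {fraction A}) :
  u = (\n_(repr u))%:F / (\d_(repr u))%:F.
Proof.
set q := repr u.
have d0 : (\d_q)%:F != 0 :> {fraction A} by rewrite tofrac_eq0 denom_ratioP.
apply: (canRL (mulfK d0)).
have -> : u = \pi q by rewrite /q reprK.
unlock FracField.tofrac; rewrite -[LHS]FracField.pi_mul.
apply/eqmodP; rewrite /= FracField.equivfE /FracField.mulf.
by rewrite !numden_Ratio ?mulf_neq0 ?oner_neq0 ?denom_ratioP // !mulr1 mulrC.
Qed.

Hypothesis h_inj : injective h.

Lemma frac_map_div (a b : A) : b != 0 ->
  frac_map (a%:F / b%:F) = (h a)%:F / (h b)%:F.
Proof.
move=> b0; rewrite /frac_map; set u := a%:F / b%:F; set q := repr u.
have hF0 (c : A) : c != 0 -> (h c)%:F != 0 :> {fraction B}.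
  by move=> c0; rewrite tofrac_eq0 -(rmorph0 h) (inj_eq h_inj).
have F0 (c : A) : c != 0 -> c%:F != 0 :> {fraction A} by rewrite tofrac_eq0.
have d0 := denom_ratioP q.
have /eqP := frac_reprE u; rewrite -/q /u eqr_div ?F0 //.
rewrite -!tofracM tofrac_eq => /eqP e.
by apply/eqP; rewrite eqr_div ?hF0 // -!tofracM -!rmorphM /= e.
Qed.

Lemma frac_map_is_zmod_morphism : zmod_morphism frac_map.
Proof.
move=> u v; rewrite [u]frac_reprE [v]frac_reprE.
move: (repr u) (repr v) => p q.
have [p0 q0] := (denom_ratioP p, denom_ratioP q).
have F0 (c : A) : c != 0 -> c%:F != 0 :> {fraction A} by rewrite tofrac_eq0.
have hF0 (c : A) : c != 0 -> (h c)%:F != 0 :> {fraction B}.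
  by move=> c0; rewrite tofrac_eq0 -(rmorph0 h) (inj_eq h_inj).
rewrite -mulNr addf_div ?F0 // -tofracN -!tofracM -tofracD.
rewrite !frac_map_div ?mulf_neq0 //.
rewrite -mulNr addf_div ?hF0 // -tofracN -!tofracM -tofracD.
by rewrite rmorphD !rmorphM rmorphN.
Qed.

Lemma frac_map_is_monoid_morphism : monoid_morphism frac_map.
Proof.
split=> [|u v].
  rewrite -[1](mulfV (oner_neq0 _)) -tofrac1 frac_map_div ?oner_neq0 //.
  by rewrite rmorph1 tofrac1 divr1.
rewrite [u]frac_reprE [v]frac_reprE.
move: (repr u) (repr v) => p q.
have [p0 q0] := (denom_ratioP p, denom_ratioP q).
rewrite mulf_div -!tofracM !frac_map_div ?mulf_neq0 // mulf_div.
by rewrite -!tofracM !rmorphM.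
Qed.

End FracMap.

Section Rename.
Variables (K : fieldType) (m n : nat) (w : 'I_m -> 'I_n).

Definition mpoly_rename : {mpoly K[m]} -> {mpoly K[n]} :=
  comp_mpoly [tuple 'X_(w i) | i < m].

HB.instance Definition _ := GRing.RMorphism.on mpoly_rename.

Lemma mpoly_rename_inj : injective w -> injective mpoly_rename.
Proof.
move=> w_inj.
pose v := [tuple if [pick i | w i == j] is Some i then 'X_i else 0 : {mpoly K[m]}
            | j < n].
apply: (can_inj (g := comp_mpoly v)) => p.
rewrite /mpoly_rename (comp_mpolyEX p) raddf_sum /= [RHS]mpolyE.
apply: eq_bigr => e _.
rewrite !comp_mpolyZ; congr (_ *: _); rewrite comp_mpolyX rmorph_prod /=.
rewrite [RHS]mpolyXE_id; apply: eq_bigr => i _.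
rewrite tnth_mktuple rmorphXn /=; congr (_ ^+ _).
rewrite comp_mpolyXU -tnth_nth tnth_mktuple.
by case: pickP => [j /eqP/w_inj -> //|/(_ i)]; rewrite eqxx.
Qed.

Definition ratfun_rename : ratfun K m -> ratfun K n := frac_map mpoly_rename.

End Rename.

Section Widen.
Variables (K : fieldType) (r s : nat).

(* The indeterminates of K[x, y] are indexed by 'I_(r + s): the first [r] are
   the x_i, the last [s] are the y_j. *)
Definition mpolyx : {mpoly K[r]} -> {mpoly K[r + s]} :=
  mpoly_rename (lshift s).
Definition mpolyy : {mpoly K[s]} -> {mpoly K[r + s]} :=
  mpoly_rename (@rshift r s).

Definition ratfunx : ratfun K r -> ratfun K (r + s) :=
  ratfun_rename (lshift s).
Definition ratfuny : ratfun K s -> ratfun K (r + s) :=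
  ratfun_rename (@rshift r s).

HB.instance Definition _ := GRing.RMorphism.on mpolyx.
HB.instance Definition _ := GRing.RMorphism.on mpolyy.

HB.instance Definition _ := GRing.isZmodMorphism.Build _ _ ratfunx
  (frac_map_is_zmod_morphism (mpoly_rename_inj (@lshift_inj r s))).
HB.instance Definition _ := GRing.isMonoidMorphism.Build _ _ ratfunx
  (frac_map_is_monoid_morphism (mpoly_rename_inj (@lshift_inj r s))).
HB.instance Definition _ := GRing.isZmodMorphism.Build _ _ ratfuny
  (frac_map_is_zmod_morphism (mpoly_rename_inj (@rshift_inj r s))).
HB.instance Definition _ := GRing.isMonoidMorphism.Build _ _ ratfuny
  (frac_map_is_monoid_morphism (mpoly_rename_inj (@rshift_inj r s))).

Lemma ratfunx_tofrac (p : {mpoly K[r]}) : ratfunx p%:F = (mpolyx p)%:F.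
Proof.
have inj := mpoly_rename_inj (K := K) (@lshift_inj r s).
rewrite -[p%:F]divr1 -tofrac1 [LHS](frac_map_div inj) ?oner_neq0 //.
by rewrite rmorph1 tofrac1 divr1.
Qed.

Lemma ratfuny_tofrac (p : {mpoly K[s]}) : ratfuny p%:F = (mpolyy p)%:F.
Proof.
have inj := mpoly_rename_inj (K := K) (@rshift_inj r s).
rewrite -[p%:F]divr1 -tofrac1 [LHS](frac_map_div inj) ?oner_neq0 //.
by rewrite rmorph1 tofrac1 divr1.
Qed.

End Widen.

Arguments mpolyx {K r} s p.
Arguments mpolyy {K} r {s} p.
Arguments ratfunx {K r} s u.
Arguments ratfuny {K} r {s} u.

Record category := Category {
  cat_ob :> Type;
  cat_hom : cat_ob -> cat_ob -> Type;
  cat_id : forall X, cat_hom X X;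
  cat_comp : forall X Y Z, cat_hom Y Z -> cat_hom X Y -> cat_hom X Z;
  cat_comp_idl : forall X Y (a : cat_hom X Y), cat_comp (cat_id Y) a = a;
  cat_comp_idr : forall X Y (a : cat_hom X Y), cat_comp a (cat_id X) = a;
  cat_compA : forall X Y Z T (c : cat_hom Z T) (b : cat_hom Y Z) (a : cat_hom X Y),
    cat_comp c (cat_comp b a) = cat_comp (cat_comp c b) a
}.
Arguments cat_hom {_} X Y.
Arguments cat_id {_} X.
Arguments cat_comp {_ X Y Z} b a.

Section ProdCategory.
Variables C D : category.

Definition prod_hom (P Q : C * D) : Type := (cat_hom P.1 Q.1 * cat_hom P.2 Q.2)%type.
Definition prod_idm (P : C * D) : prod_hom P P := (cat_id P.1, cat_id P.2).
Definition prod_comp (P Q R : C * D) (b : prod_hom Q R) (a : prod_hom P Q) :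
  prod_hom P R := (cat_comp b.1 a.1, cat_comp b.2 a.2).

Lemma prod_comp_idl P Q (a : prod_hom P Q) : prod_comp (prod_idm Q) a = a.
Proof. by case: a => a a'; rewrite /prod_comp /= !cat_comp_idl. Qed.

Lemma prod_comp_idr P Q (a : prod_hom P Q) : prod_comp a (prod_idm P) = a.
Proof. by case: a => a a'; rewrite /prod_comp /= !cat_comp_idr. Qed.

Lemma prod_compA P Q R S (c : prod_hom R S) (b : prod_hom Q R)
  (a : prod_hom P Q) :
  prod_comp c (prod_comp b a) = prod_comp (prod_comp c b) a.
Proof. by rewrite /prod_comp /= !cat_compA. Qed.

Definition prod_category : category :=
  Category prod_comp_idl prod_comp_idr prod_compA.

End ProdCategory.

Record is_functor (C D : category) (Fob : C -> D)
    (Fhom : forall X Y : C, cat_hom X Y -> cat_hom (Fob X) (Fob Y)) : Prop := IsFunctor {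
  functor_id : forall X, Fhom X X (cat_id X) = cat_id (Fob X);
  functor_comp : forall X Y Z (b : cat_hom Y Z) (a : cat_hom X Y),
    Fhom X Z (cat_comp b a) = cat_comp (Fhom Y Z b) (Fhom X Y a)
}.

Definition is_bifunctor (A B C : category) (Fob : A -> B -> C)
    (Fhom : forall (X X' : A) (Y Y' : B),
      cat_hom X X' -> cat_hom Y Y' -> cat_hom (Fob X Y) (Fob X' Y')) : Prop :=
  @is_functor (prod_category A B) C
    (fun P => Fob P.1 P.2) (fun P Q h => Fhom P.1 Q.1 P.2 Q.2 h.1 h.2).

(* Both 3-matrix factorizations (m = n) and their morphisms are triplets of
   matrices of a common shape. *)
Record mx3 (F : Type) (m n : nat) := Mx3 {
  mxa : 'M[F]_(m, n);
  mxb : 'M[F]_(m, n);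
  mxc : 'M[F]_(m, n)
}.

Section MF3.
Variables (K : fieldType) (d : nat) (f : {mpoly K[d]}).
Local Notation Kx := (ratfun K d).

Definition is_mf3 n (X : mx3 Kx n n) : bool :=
  mxa X *m mxb X *m mxc X == (f%:F : Kx)%:M.

Record mf3 := Mf3 {
  mf3_size : nat;
  mf3_mx :> mx3 Kx mf3_size mf3_size;
  mf3P : is_mf3 mf3_mx
}.

Definition is_mf3_hom n1 n2 (X : mx3 Kx n1 n1) (Y : mx3 Kx n2 n2)
    (h : mx3 Kx n2 n1) : bool :=
  [&& mxa h *m mxa X == mxa Y *m mxb h,
      mxb Y *m mxc h == mxb h *m mxb X
    & mxc h *m mxc X == mxc Y *m mxa h].

Record mf3_hom (X Y : mf3) := Mf3Hom {
  mf3_hom_mx :> mx3 Kx (mf3_size Y) (mf3_size X);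
  mf3_homP : is_mf3_hom X Y mf3_hom_mx
}.

Lemma mf3_hom_inj (X Y : mf3) : injective (@mf3_hom_mx X Y).
Proof.
by case=> h hP [k kP] /= e; case: k / e kP => kP; rewrite (bool_irrelevance hP kP).
Qed.

Definition mx3_id n : mx3 Kx n n := Mx3 1%:M 1%:M 1%:M.
Definition mx3_comp m n p (b : mx3 Kx m n) (a : mx3 Kx n p) : mx3 Kx m p :=
  Mx3 (mxa b *m mxa a) (mxb b *m mxb a) (mxc b *m mxc a).

Lemma mf3_id_subproof (X : mf3) : is_mf3_hom X X (mx3_id (mf3_size X)).
Proof. by rewrite /is_mf3_hom /= !mulmx1 !mul1mx !eqxx. Qed.

Definition mf3_id (X : mf3) : mf3_hom X X := Mf3Hom (mf3_id_subproof X).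

Lemma mf3_comp_subproof (X Y Z : mf3) (b : mf3_hom Y Z) (a : mf3_hom X Y) :
  is_mf3_hom X Z (mx3_comp b a).
Proof.
case: a b => a /= /and3P[/eqP a1 /eqP a2 /eqP a3].
case=> b /= /and3P[/eqP b1 /eqP b2 /eqP b3].
apply/and3P; split; apply/eqP => /=.
- by rewrite -mulmxA a1 !mulmxA b1.
- by rewrite mulmxA b2 -!mulmxA a2.
- by rewrite -mulmxA a3 !mulmxA b3.
Qed.

Definition mf3_comp (X Y Z : mf3) (b : mf3_hom Y Z) (a : mf3_hom X Y) :
  mf3_hom X Z := Mf3Hom (mf3_comp_subproof b a).

Lemma mf3_comp_idl X Y (a : mf3_hom X Y) : mf3_comp (mf3_id Y) a = a.
Proof.
by apply: mf3_hom_inj; case: a => -[a b c] ?; rewrite /= /mx3_comp /= !mul1mx.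
Qed.

Lemma mf3_comp_idr X Y (a : mf3_hom X Y) : mf3_comp a (mf3_id X) = a.
Proof.
by apply: mf3_hom_inj; case: a => -[a b c] ?; rewrite /= /mx3_comp /= !mulmx1.
Qed.

Lemma mf3_compA X Y Z T (c : mf3_hom Z T) (b : mf3_hom Y Z) (a : mf3_hom X Y) :
  mf3_comp c (mf3_comp b a) = mf3_comp (mf3_comp c b) a.
Proof. by apply: mf3_hom_inj; rewrite /= /mx3_comp /= !mulmxA. Qed.

Definition MF3 : category := Category mf3_comp_idl mf3_comp_idr mf3_compA.

End MF3.

(* The same formula is used for objects and for morphisms. *)
Definition mx3_tens (K : fieldType) (r s m n p q : nat)
    (A : mx3 (ratfun K r) m n) (B : mx3 (ratfun K s) p q) :
    mx3 (ratfun K (r + s)) (m * p) (n * q) :=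
  Mx3 (map_mx (ratfunx s) (mxa A) *t map_mx (ratfuny r) (mxa B))
      (map_mx (ratfunx s) (mxb A) *t map_mx (ratfuny r) (mxb B))
      (map_mx (ratfunx s) (mxc A) *t map_mx (ratfuny r) (mxc B)).

(* Main.v *)
Require Import Defs.
From mathcomp Require Import all_boot all_algebra.
From mathcomp Require Import mpoly mxtens.

(** Everything rests on the mixed product rule
    (A tens B) * (C tens D) = (A * C) tens (B * D) for the Kronecker product,
    used in the form [mulmx_tens_embed], where A, C live over K(x), B, D over
    K(y), and both are carried into K(x, y) by the embeddings of fraction
    fields. An identity between products of matrices over K(x) and one between
    products over K(y) can therefore be tensored factor by factor.

    Tensoring the factorizations of f and g gives (f I_n) tens (g I_m), which
    is fg I_nm ([tens_scalar_scalar]), the embeddings sending f and g to their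
    images in K[x, y]. Tensoring the three commuting squares of two morphisms
    gives the squares of their tensor product. Compatibility with composition
    is the rule itself, applied to each component, and identities are preserved
    because I_n tens I_m = I_nm. Since a morphism is determined by its matrices
    ([mf3_hom_inj]), these matrix equalities are the functor laws. *)

Import GRing.Theory.
Local Open Scope ring_scope.

(** At row (i, k) and column (j, l) the entry is the product of a, if i = j,
    and b, if k = l; as pairs are encoded injectively, it is ab exactly on the
    diagonal. *)
Lemma tens_scalar_scalar (R : comPzRingType) n m (a b : R) :
  (a%:M : 'M_n) *t (b%:M : 'M_m) = (a * b)%:M.
Proof.
apply/matrixP=> i j; rewrite -(mxtens_unindexK i) -(mxtens_unindexK j).
case: (mxtens_unindex i) (mxtens_unindex j) => [i1 i2] [j1 j2].
rewrite tensmxE !mxE (can_eq (@mxtens_indexK _ _)) xpair_eqE.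
by rewrite mulrnAl mulrnAr -mulrnA mulnb andbC.
Qed.

Section EmbeddedKronecker.
Variables (K : fieldType) (r s : nat).
Local Notation Kx := (ratfun K r).
Local Notation Ky := (ratfun K s).

(** The embeddings of K(x) and K(y) in K(x, y) are ring morphisms, so they
    commute with matrix products and the mixed product rule passes through
    them. *)
Lemma mulmx_tens_embed m n k p q l
    (A : 'M[Kx]_(m, n)) (A' : 'M[Kx]_(n, k))
    (B : 'M[Ky]_(p, q)) (B' : 'M[Ky]_(q, l)) :
  (map_mx (ratfunx s) A *t map_mx (ratfuny r) B) *m
    (map_mx (ratfunx s) A' *t map_mx (ratfuny r) B') =
  map_mx (ratfunx s) (A *m A') *t map_mx (ratfuny r) (B *m B').
Proof. by rewrite tensmx_mul !map_mxM. Qed.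

Lemma mx3_tens_id n m :
  mx3_tens (mx3_id K r n) (mx3_id K s m) = mx3_id K (r + s) (n * m).
Proof.
by rewrite /mx3_tens /= !map_mx1 tens_scalar_scalar mulr1.
Qed.

Lemma mx3_tens_comp m n k p q l
    (b : mx3 Kx m n) (a : mx3 Kx n k) (b' : mx3 Ky p q) (a' : mx3 Ky q l) :
  mx3_tens (mx3_comp b a) (mx3_comp b' a') =
  mx3_comp (mx3_tens b b') (mx3_tens a a').
Proof. by rewrite /mx3_comp /= !mulmx_tens_embed. Qed.

Variables (f : {mpoly K[r]}) (g : {mpoly K[s]}).

Lemma is_mf3_tens n m (X : mx3 Kx n n) (Y : mx3 Ky m m) :
  is_mf3 f X -> is_mf3 g Y ->
  is_mf3 (mpolyx s f * mpolyy r g) (mx3_tens X Y).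
Proof.
move=> /eqP eX /eqP eY; apply/eqP; rewrite /= !mulmx_tens_embed eX eY.
rewrite !map_scalar_mx tens_scalar_scalar /= ratfunx_tofrac ratfuny_tofrac.
by rewrite -tofracM.
Qed.

Lemma is_mf3_hom_tens n1 n2 m1 m2
    (X : mx3 Kx n1 n1) (X' : mx3 Kx n2 n2) (h : mx3 Kx n2 n1)
    (Y : mx3 Ky m1 m1) (Y' : mx3 Ky m2 m2) (k : mx3 Ky m2 m1) :
  is_mf3_hom X X' h -> is_mf3_hom Y Y' k ->
  is_mf3_hom (mx3_tens X Y) (mx3_tens X' Y') (mx3_tens h k).
Proof.
move=> /and3P[/eqP h1 /eqP h2 /eqP h3] /and3P[/eqP k1 /eqP k2 /eqP k3].
apply/and3P; split; apply/eqP; rewrite /= !mulmx_tens_embed.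
- by rewrite h1 k1.
- by rewrite h2 k2.
- by rewrite h3 k3.
Qed.

End EmbeddedKronecker.

Arguments is_mf3_tens {K r s f g n m X Y}.
Arguments is_mf3_hom_tens {K r s n1 n2 m1 m2 X X' h Y Y' k}.

Theorem theorem5p1 (K : fieldType) (r s : nat)
    (f : {mpoly K[r]}) (g : {mpoly K[s]}) :
  (forall (n m : nat) (X : mx3 (ratfun K r) n n) (Y : mx3 (ratfun K s) m m),
     is_mf3 f X -> is_mf3 g Y ->
     is_mf3 (mpolyx s f * mpolyy r g)
       (mx3_tens X Y : mx3 (ratfun K (r + s)) (n * m) (n * m)))
  /\
  exists (Tob : forall (X : mf3 f) (Y : mf3 g),
            is_mf3 (mpolyx s f * mpolyy r g) (mx3_tens X Y))
         (Thom : forall (X X' : mf3 f) (Y Y' : mf3 g)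
                   (a : mf3_hom X X') (b : mf3_hom Y Y'),
            is_mf3_hom (mx3_tens X Y) (mx3_tens X' Y') (mx3_tens a b)),
    @is_bifunctor (MF3 f) (MF3 g) (MF3 (mpolyx s f * mpolyy r g))
      (fun X Y => Mf3 (Tob X Y))
      (fun X X' Y Y' a b =>
         Mf3Hom (X := Mf3 (Tob X Y)) (Y := Mf3 (Tob X' Y')) (Thom X X' Y Y' a b)).
Proof.
split=> [n m X Y|]; first exact: is_mf3_tens.
exists (fun X Y => is_mf3_tens (mf3P X) (mf3P Y)).
exists (fun X X' Y Y' a b =>
          is_mf3_hom_tens (mf3_homP a) (mf3_homP b)).
split=> [[X Y]|[X Y] [X' Y'] [X'' Y''] b a]; apply: mf3_hom_inj => /=.
- exact: mx3_tens_id.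
- exact: mx3_tens_comp.
Qed.
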